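(* $\alpha_{\mathsf{RePair}}(2,n)\in\Omega\left(\log n/\log\log n\right)$. That is, there is a constant $c>0$ and infinitely many $n$ for which there is a word $w\in\{a,b\}^n$ over a two-letter alphabet with $|\mathsf{RePair}(w)|/g(w)\ge c\log n/\log\log n$.
   Context: All logarithms are to base 2. A straight-line program (SLP) is a tuple $\mathbb A=(N,\Sigma,P,S)$ where $N$ is a finite set of nonterminals disjoint from the alphabet $\Sigma$, $S\in N$ is the start nonterminal, and $P$ contains exactly one production $A\to w$ with $w\in(N\cup\Sigma)^+$ for each $A\in N$, such that the relation ''$B$ occurs in the right-hand side of $A$'' is acyclic. Each nonterminal derives a unique word, and $\mathrm{val}(\mathbb A)$ is the word derived from $S$. The size is $|\mathbb A|=\sum_{(A\to w)\in P}|w|$. For a nonempty word $w$, $g(w)$ is the minimum size of an SLP deriving $w$. For an SLP $\mathbb A$, a word $\gamma\in(N\cup\Sigma)^+$ is a maximal string of $\mathbb A$ if $|\gamma|\ge 2$, $\gamma$ occurs at least twice without overlap in the right-hand sides of $\mathbb A$, and no strictly longer word occurs at least as many times without overlap in the right-hand sides. The compressor $\mathsf{RePair}$ on input $w$ starts with the SLP with the single rule $S\to w$; in each round it selects a maximal string $\gamma$ with the largest number of non-overlapping occurrences, replaces a largest set of pairwise non-overlapping occurrences of $\gamma$ (chosen from left to right) in the right-hand sides by a fresh nonterminal $X$, and adds the rule $X\to\gamma$. It stops when no maximal string exists; $\mathsf{RePair}(w)$ denotes the resulting SLP. The approximation ratio is $\alpha_{\mathsf{RePair}}(w)=|\mathsf{RePair}(w)|/g(w)$,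 and $\alpha_{\mathsf{RePair}}(k,n)=\max\{\alpha_{\mathsf{RePair}}(w)\mid w\in[1,k]^n\}$, the maximum over all words of length $n$ over a $k$-letter alphabet. *)

(* Defs.v *)
From mathcomp Require Import all_boot.
From Stdlib Require Import Reals.

Set Implicit Arguments.
Unset Strict Implicit.
Unset Printing Implicit Defensive.

(** Symbols: [inl a] is the terminal letter [a] (letters are natural numbers,
    the alphabet [1,k] being {1,...,k}); [inr X] is the nonterminal [X].
    Hence nonterminals and terminals are disjoint by construction. *)
Definition sym := (nat + nat)%type.

Record slp := SLP { rules : seq (nat * seq sym); start : nat }.

Definition nonterms (A : slp) : seq nat := map fst (rules A).

Definition occurs_rel (A : slp) : rel nat :=
  fun C B => has (fun r => (r.1 == C) && (inr B \in r.2)) (rules A).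

Definition slp_wf (A : slp) : Prop :=
  [/\ uniq (nonterms A),
      start A \in nonterms A,
      all (fun r => 0 < size r.2) (rules A),
      all (fun r => all (fun x => match x with
                                  | inl _ => true
                                  | inr B => B \in nonterms A end) r.2) (rules A)
    & forall (C : nat) (p : seq nat),
        path (occurs_rel A) C p -> last C p = C -> p = [::]].

Definition slp_size (A : slp) : nat := sumn (map (fun r => size r.2) (rules A)).

Inductive dsym (A : slp) : sym -> seq nat -> Prop :=
| dsym_T (a : nat) : dsym A (inl a) [:: a]
| dsym_N (X : nat) (rhs : seq sym) (u : seq nat) :
    (X, rhs) \in rules A -> dseq A rhs u -> dsym A (inr X) u
with dseq (A : slp) : seq sym -> seq nat -> Prop :=
| dseq_nil : dseq A [::] [::]
| dseq_cons (x : sym) (s : seq sym) (u v : seq nat) :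
    dsym A x u -> dseq A s v -> dseq A (x :: s) (u ++ v).

Definition slp_for (A : slp) (w : seq nat) : Prop :=
  slp_wf A /\ dsym A (inr (start A)) w.

Definition is_g (w : seq nat) (m : nat) : Prop :=
  (exists A, slp_for A w /\ slp_size A = m) /\
  (forall A, slp_for A w -> m <= slp_size A).

(** Maximum number of pairwise non-overlapping occurrences of [g] in [s]
    (dynamic programming: either skip the first position or, if [g] occurs
    there, take that occurrence and jump past it). [fuel] = [size s]. *)
Fixpoint occ_aux (g : seq sym) (fuel : nat) (s : seq sym) : nat :=
  match fuel, s with
  | 0, _ => 0
  | _, [::] => 0
  | f.+1, x :: s' =>
      maxn (occ_aux g f s')
           (if (0 < size g) && prefix g s
            then (occ_aux g f (drop (size g) s)).+1 else 0)
  end.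

Definition occ_seq (g s : seq sym) : nat := occ_aux g (size s) s.

Definition occ (A : slp) (g : seq sym) : nat :=
  sumn (map (fun r => occ_seq g r.2) (rules A)).

Definition maximal_string (A : slp) (g : seq sym) : Prop :=
  [/\ 2 <= size g, 2 <= occ A g &
      forall g' : seq sym, size g < size g' -> occ A g' < occ A g].

Fixpoint repl_aux (g : seq sym) (X : nat) (fuel : nat) (s : seq sym) : seq sym :=
  match fuel, s with
  | 0, _ => s
  | _, [::] => [::]
  | f.+1, x :: s' =>
      if prefix g s then inr X :: repl_aux g X f (drop (size g) s)
      else x :: repl_aux g X f s'
  end.

Definition repl_seq (g : seq sym) (X : nat) (s : seq sym) : seq sym :=
  repl_aux g X (size s) s.

Definition fresh (A : slp) : nat := (foldr maxn 0 (nonterms A)).+1.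

Definition replace_round (A : slp) (g : seq sym) : slp :=
  let X := fresh A in
  SLP (rcons (map (fun r => (r.1, repl_seq g X r.2)) (rules A)) (X, g))
      (start A).

Definition repair_step (A B : slp) : Prop :=
  exists g, [/\ maximal_string A g,
                (forall g', maximal_string A g' -> occ A g' <= occ A g) &
                B = replace_round A g].

Inductive repair_run : slp -> slp -> Prop :=
| run_stop (A : slp) : (forall g, ~ maximal_string A g) -> repair_run A A
| run_step (A B C : slp) : repair_step A B -> repair_run B C -> repair_run A C.

Definition repair_init (w : seq nat) : slp := SLP [:: (0, map inl w)] 0.

(** [A] is a possible output RePair(w) (any admissible tie-breaking). *)
Definition repair_result (w : seq nat) (A : slp) : Prop :=
  repair_run (repair_init w) A.

Definition log2 (x : R) : R := (ln x / ln 2)%R.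

(* Main.v *)
(* The word is the concatenation of the blocks a^(e_i) b, where e_0 = 1,
   e_(i+1) = 2 e_i + b_(i+1) and (b_i) is a bit sequence of length Theta(2^p) in
   which no window of length O(p) occurs twice.  Doubling gives a program of size O(2^p).
   RePair, however, is forced to start with X_1 -> a a, X_2 -> X_1 X_1, ..., because
   the longest runs dominate every other factor; afterwards each e_i is spelled out in
   binary over the X_j, with Omega(2^p) digits.  A window of O(p) consecutive digits
   occurs only once, whereas whatever RePair replaces from then on occurs twice; hence
   every symbol of the final start rule covers O(p) digits, and the start rule has
   length Omega(4^p / p).  As log n = Theta(2^p), this is the claimed ratio. *)

Require Import Defs.
From mathcomp Require Import all_boot zify.
From Stdlib Require Import Reals Lra Classical.

Set Implicit Arguments.
Unset Strict Implicit.
Unset Printing Implicit Defensive.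

(* [Reals] rebinds the exponentiation of [nat_scope] to [Nat.pow]. *)
Local Notation "m ^ n" := (expn m n) : nat_scope.

(** * Occurrences and replacement *)

Lemma occ_aux_fuel (g s : seq sym) (f : nat) :
  size s <= f -> occ_aux g f s = occ_seq g s.
Proof.
rewrite /occ_seq.
have H f1 f2 t : size t <= f1 -> size t <= f2 -> occ_aux g f1 t = occ_aux g f2 t.
  elim: f1 f2 t => [|f1 IH] [|f2] [|x t] //= h1 h2.
  rewrite (IH f2) //; case: ifP => // /andP[g0 _].
  by rewrite (IH f2) // size_drop /=; lia.
by move=> h; apply: H.
Qed.

Lemma occ_seq_cons (g s : seq sym) (x : sym) :
  occ_seq g (x :: s) =
  maxn (occ_seq g s)
       (if (0 < size g) && prefix g (x :: s)
        then (occ_seq g (drop (size g) (x :: s))).+1 else 0).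
Proof.
rewrite {1}/occ_seq [in LHS]/= -/(prefix g (x :: s)); congr maxn; case: ifP => // /andP[g0 _].
by rewrite occ_aux_fuel // size_drop /=; lia.
Qed.

Lemma repl_aux_fuel (g s : seq sym) (X f : nat) :
  0 < size g -> size s <= f -> repl_aux g X f s = repl_seq g X s.
Proof.
move=> g0; rewrite /repl_seq.
have H f1 f2 t : size t <= f1 -> size t <= f2 ->
    repl_aux g X f1 t = repl_aux g X f2 t.
  elim: f1 f2 t => [|f1 IH] [|f2] [|x t] //= h1 h2.
  rewrite (IH f2 t) // (IH f2 (drop _ _)) // size_drop /=; lia.
by move=> h; apply: H.
Qed.

Lemma repl_seq_cons (g s : seq sym) (X : nat) (x : sym) :
  0 < size g ->
  repl_seq g X (x :: s) =
  if prefix g (x :: s) then inr X :: repl_seq g X (drop (size g) (x :: s))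
  else x :: repl_seq g X s.
Proof.
move=> g0; rewrite {1}/repl_seq [in LHS]/= -/(prefix g (x :: s)).
by rewrite !repl_aux_fuel // size_drop /=; lia.
Qed.

Lemma seq_size_ind (T : Type) (P : seq T -> Prop) :
  (forall s, (forall t, size t < size s -> P t) -> P s) -> forall s, P s.
Proof.
move=> H s; have [n] := ubnP (size s); elim: n s => // n IH s hs.
by apply: H => t ht; apply: IH; lia.
Qed.

(** Disjoint occurrences use disjoint positions of [s], and each contributes [count P g] letters.
    This caps the frequency of every competitor of the pair chosen in the first rounds. *)
Lemma occ_seq_count (P : pred sym) (g s : seq sym) :
  occ_seq g s * count P g <= count P s.
Proof.
elim/seq_size_ind: s => -[//|x s] IH.
rewrite occ_seq_cons maxnMl geq_max; apply/andP; split.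
  by apply: leq_trans (IH s _) _ => //=; lia.
case: ifP => // /andP[g0 /prefixP[t E]]; move: IH; rewrite E => IH.
rewrite drop_size_cat // count_cat mulSn leq_add2l; apply: IH.
by rewrite size_cat; lia.
Qed.

Lemma occ_seq_gt0 (g s : seq sym) : 0 < occ_seq g s -> infix g s.
Proof.
elim: s => // x s IH; rewrite occ_seq_cons leq_max => /orP[/IH h|].
  by rewrite infix_consl h orbT.
by case: ifP => // /andP[_ h] _; rewrite infix_consl h.
Qed.

Lemma occ_seq_gt1 (g s : seq sym) : 1 < occ_seq g s ->
  exists p q r, s = p ++ g ++ q ++ g ++ r.
Proof.
elim: s => // x s IH; rewrite occ_seq_cons leq_max => /orP[/IH|].
  by move=> [p [q [r ->]]]; exists (x :: p), q, r.
case: ifP => // /andP[_ /prefixP[t ->]]; rewrite ltnS drop_size_cat //.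
by move=> /occ_seq_gt0 /infixP[q [r ->]]; exists [::], q, r.
Qed.

Lemma occ_gt0 (A : slp) (g : seq sym) :
  0 < occ A g -> exists2 r, r \in rules A & infix g r.2.
Proof.
rewrite /occ; elim: (rules A) => //= r l IH; rewrite addn_gt0.
case/orP => [/occ_seq_gt0 h|/IH[r' h1 h2]]; first by exists r; rewrite ?inE ?eqxx.
by exists r' => //; rewrite inE h1 orbT.
Qed.

Lemma occ_count (P : pred sym) (A : slp) (g : seq sym) :
  occ A g * count P g <= sumn [seq count P r.2 | r <- rules A].
Proof.
rewrite /occ; elim: (rules A) => //= r l IH.
by rewrite mulnDl leq_add // occ_seq_count.
Qed.

(** A run of [c] copies of [x] yields [c./2] disjoint pairs and wastes at most one copy; the runs
    number at most one more than the other letters. *)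
Lemma occ_seq_pair (x : sym) (s : seq sym) :
  count (pred1 x) s <= 2 * occ_seq [:: x; x] s + count (predC (pred1 x)) s + 1.
Proof.
elim/seq_size_ind: s => -[//|y s] IH.
have := IH s (leqnn _); rewrite occ_seq_cons /= => IH1.
case: (eqVneq y x) => [_|_] /=; last by lia.
case: s IH IH1 => [|z s] IH IH1; first by rewrite /=; lia.
rewrite /=; case: (eqVneq z x) => [_|nzx] /=; have := IH s (leqnSn _).
  by rewrite prefix0s drop0 /=; lia.
by rewrite (occ_seq_cons _ s) /=; lia.
Qed.

Lemma repl_seq_notin (g s : seq sym) (X : nat) (x : sym) :
  x \in g -> x \notin s -> repl_seq g X s = s.
Proof.
move=> xg; have g0 : 0 < size g by case: g xg.
elim: s => // y s IH xs; rewrite repl_seq_cons //; case: ifP.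
  by move=> /prefixP[t E]; move: xs; rewrite E mem_cat xg.
by rewrite IH //; move: xs; rewrite inE negb_or => /andP[].
Qed.

Lemma repl_seq_cat_neq (x : sym) (X : nat) (u s : seq sym) :
  x \notin u -> repl_seq [:: x; x] X (u ++ s) = u ++ repl_seq [:: x; x] X s.
Proof.
elim: u => // y u IH /=; rewrite inE negb_or => /andP[nxy xu].
by rewrite repl_seq_cons //= (negbTE nxy) /= IH.
Qed.

(** Scanning from the left leaves the unpaired [x] of an odd run at its right end, which puts the
    binary digits in decreasing order of weight. *)
Lemma repl_seq_run (x : sym) (X c : nat) (u s : seq sym) :
  x \notin u -> 0 < size u ->
  repl_seq [:: x; x] X (nseq c x ++ u ++ s) =
  nseq c./2 (inr X) ++ nseq (odd c) x ++ u ++ repl_seq [:: x; x] X s.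
Proof.
move=> xu u0; have [n] := ubnP c; elim: n c => // n IH [|[|c]] hc.
- by rewrite /= repl_seq_cat_neq.
- case: u xu u0 {IH} => // y u xu _.
  rewrite [LHS]/= repl_seq_cons //=; move: (xu); rewrite inE negb_or => /andP[nxy _].
  rewrite eqxx (negbTE nxy) /=; congr cons.
  by rewrite (@repl_seq_cat_neq x X (y :: u)).
- rewrite [LHS]/= repl_seq_cons //= !eqxx /= prefix0s /= drop0 IH; last by lia.
  by rewrite negbK.
Qed.

Lemma repl_seq_mem (g s : seq sym) (X : nat) (x : sym) : 0 < size g ->
  x \in repl_seq g X s -> x = inr X \/ x \in s.
Proof.
move=> g0; elim/seq_size_ind: s => -[//|y s] IH; rewrite repl_seq_cons //.
case: ifP => [/prefixP[t E]|_]; rewrite in_cons => /orP[/eqP|].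
- by left.
- move: IH; rewrite E drop_size_cat // mem_cat => IH h.
  case: (IH t _ h) => [|->|->]; first by rewrite size_cat; lia.
    by left.
  by right; rewrite orbT.
- by move=> ->; right; rewrite mem_head.
- by move=> /IH[|->|h]; [|left|right; rewrite in_cons h orbT].
Qed.

Lemma repl_seq_expand (E : sym -> seq sym) (g s : seq sym) (X : nat) :
  0 < size g -> E (inr X) = flatten (map E g) ->
  flatten (map E (repl_seq g X s)) = flatten (map E s).
Proof.
move=> g0 EX; elim/seq_size_ind: s => -[//|y s] IH; rewrite repl_seq_cons //.
case: ifP => [/prefixP[t h]|_]; last by rewrite /= IH.
move: IH; rewrite h drop_size_cat // => IH.
by rewrite map_cat flatten_cat /= EX IH // size_cat; lia.
Qed.

(** ** Termination *)

(** Counts the replacements that [repl_aux] performs. Rounds are selected by the optimum [occ_seq]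
    but shorten rules by this number, so termination needs a comparison of the two. *)
Fixpoint greedy_aux (g : seq sym) (f : nat) (s : seq sym) : nat :=
  match f, s with
  | f.+1, x :: s' => if prefix g s then (greedy_aux g f (drop (size g) s)).+1
                     else greedy_aux g f s'
  | _, _ => 0
  end.

Definition greedy (g s : seq sym) : nat := greedy_aux g (size s) s.

Lemma greedy_cons (g s : seq sym) (x : sym) : 0 < size g ->
  greedy g (x :: s) = if prefix g (x :: s)
    then (greedy g (drop (size g) (x :: s))).+1 else greedy g s.
Proof.
move=> g0; have H f1 f2 t : size t <= f1 -> size t <= f2 ->
    greedy_aux g f1 t = greedy_aux g f2 t.
  elim: f1 f2 t => [|f1 IH] [|f2] [|y t] //= h1 h2.
  rewrite (IH f2 t) // (IH f2 (drop _ _)) // size_drop /=; lia.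
rewrite {1}/greedy [in LHS]/= -/(prefix g (x :: s)) (H _ _ _ _ (leqnn _)) //.
by rewrite size_drop /=; lia.
Qed.

(** The two bounds feed each other: when [g] is a prefix, the first uses the second on the tail with
    [m] one less than [size g], and the second uses the monotonicity [M] obtained from the first. *)
Lemma greedy_drop (g s : seq sym) : 0 < size g ->
  greedy g (behead s) <= greedy g s /\
  (forall m, m <= size g -> greedy g s <= (greedy g (drop m s)).+1).
Proof.
move=> g0; elim/seq_size_ind: s => -[|x s] IH; first by [].
have IHs := IH s (leqnn _).
have M t m : size t <= size s -> greedy g (drop m t) <= greedy g t.
  elim: m t => [|m IHm] t ht; first by rewrite drop0.
  rewrite -addn1 -drop_drop drop1; apply: leq_trans (IHm _ _) _.
    by rewrite size_behead; lia.
  by case: (IH t ht).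
split.
  rewrite /= greedy_cons //; case: ifP => // _.
  case: (size g) g0 IHs => // n _ [_ H] /=; exact: H.
case=> [|m] hm; first by rewrite drop0.
rewrite greedy_cons //; case: ifP => _ /=.
  rewrite ltnS -(subnK hm) -[X in drop X]/((size g - m.+1) + m.+1).
  case: (size g) hm {IHs} => // n hm.
  rewrite subSS addnS /= -drop_drop; apply: M; rewrite size_drop; lia.
by case: IHs => _; apply; lia.
Qed.

(** The left-to-right choice is optimal: taking an occurrence is the greedy step, and skipping a
    position cannot help by [greedy_drop]. *)
Lemma occ_seq_greedy (g s : seq sym) : occ_seq g s <= greedy g s.
Proof.
case: (posnP (size g)) => [/size0nil ->|g0].
  have -> : occ_seq [::] s = 0 by elim: s => // x s IH; rewrite occ_seq_cons IH.
  by [].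
elim/seq_size_ind: s => -[|x s] IH //; rewrite occ_seq_cons geq_max.
case: (greedy_drop (x :: s) g0) => /= h _; apply/andP; split.
  by apply: leq_trans (IH s _) h => /=; lia.
rewrite g0 greedy_cons //=; case: ifP => // _; rewrite ltnS; apply: IH.
by rewrite size_drop /=; lia.
Qed.

Lemma size_repl_seq (g s : seq sym) (X : nat) : 1 < size g ->
  (size (repl_seq g X s)).-1 + greedy g s * (size g).-1 = (size s).-1.
Proof.
move=> g1; have g0 : 0 < size g by lia.
(* Nonemptiness is carried along because the predecessors in the goal are truncated. *)
suff: size (repl_seq g X s) + greedy g s * (size g).-1 = size s /\
      (0 < size s -> 0 < size (repl_seq g X s)).
  move=> []; move: (greedy g s * _) => k h.
  by case: (posnP (size s)) => [|s0 /(_ isT)]; lia.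
elim/seq_size_ind: s => -[//|x s] IH; rewrite repl_seq_cons // greedy_cons //.
case: ifP => [/prefixP[t E]|_] /=; last by have := IH s (leqnn _); lia.
move: IH; rewrite E -[(size s).+1]/(size (x :: s)) E drop_size_cat // => IH.
have [|h _] := IH t _; first by rewrite size_cat; lia.
by rewrite size_cat; nia.
Qed.

Lemma ex_argmax (T : Type) (P : T -> Prop) (f : T -> nat) (b : nat) :
  (exists x, P x) -> (forall x, P x -> f x <= b) ->
  exists x, P x /\ forall y, P y -> f y <= f x.
Proof.
move=> [x Px] fb; have [n] := ubnP (b - f x); elim: n x Px => // n IH x Px hn.
case: (classic (exists2 y, P y & f x < f y)) => [[y Py fy]|h].
  by apply: (IH y Py); have := fb _ Py; lia.
exists x; split=> // y Py; rewrite leqNgt; apply/negP => fy; apply: h.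
by exists y.
Qed.

Lemma ex_minimum (P : nat -> Prop) (b : nat) : P b ->
  exists m, [/\ P m, m <= b & forall n, P n -> m <= n].
Proof.
elim/ltn_ind: b => b IH Pb.
case: (classic (exists2 n, P n & n < b)) => [[n Pn nb]|h].
  by have [m [Pm mn mmin]] := IH n nb Pn; exists m; split=> //; lia.
exists b; split=> // n Pn; rewrite leqNgt; apply/negP => nb; apply: h.
by exists n.
Qed.

Lemma maximal_step (A : slp) (g : seq sym) : maximal_string A g ->
  exists B, repair_step A B.
Proof.
move=> mg; have [||g' [mg' hg']] := @ex_argmax _ (maximal_string A) (occ A)
  (sumn [seq count predT r.2 | r <- rules A]).
- by exists g.
- move=> h [h1 h2 _]; apply: leq_trans (occ_count predT A h).
  by rewrite count_predT leq_pmulr; lia.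
by exists (replace_round A g'), g'.
Qed.

(** The measure [mu] sums the lengths of right-hand sides, each minus one. With at least two
    replacements of [g] it loses at least [2 * (size g).-1], while the new rule gives back only
    [(size g).-1]. *)
Lemma repair_run_exists (A : slp) : exists B, repair_run A B.
Proof.
pose mu A := sumn [seq (size r.2).-1 | r <- rules A].
have [n] := ubnP (mu A); elim: n A => // n IH A hn.
case: (classic (exists g, maximal_string A g)) => [[g /maximal_step[B AB]]|h].
  2: by exists A; apply: run_stop => g mg; apply: h; exists g.
case: (AB) => g' [[g2 o2 _] _ EB].
have [|C BC] := IH B; last by exists C; apply: run_step BC.
suff : mu B < mu A by lia.
have {o2} : 2 <= sumn [seq greedy g' r.2 | r <- rules A].
  apply: leq_trans o2 _; rewrite /occ.
  by elim: (rules A) => //= r l IHl; rewrite leq_add // occ_seq_greedy.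
suff : sumn [seq (size r.2).-1 | r <-
          [seq (r.1, repl_seq g' (fresh A) r.2) | r <- rules A]] +
       sumn [seq greedy g' r.2 | r <- rules A] * (size g').-1 = mu A.
  rewrite EB /mu /= map_rcons sumn_rcons.
  move=> <- G2; rewrite ltn_add2l -[X in X < _]mul1n ltn_mul2r G2 andbT /=; lia.
rewrite /mu; elim: (rules A) => //= r l IHl.
by rewrite -IHl -(size_repl_seq r.2 (fresh A) g2) mulnDl !addnA; congr addn; rewrite addnAC.
Qed.

(** * Windows of constrained symbols *)

Fixpoint windows (P : pred sym) (m : nat) (s : seq sym) : nat :=
  if s is _ :: s' then (m <= size s) && all P (take m s) + windows P m s' else 0.

Lemma windows_cons (P : pred sym) (m : nat) (s : seq sym) (x : sym) :
  windows P m (x :: s) =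
  (m <= size (x :: s)) && all P (take m (x :: s)) + windows P m s.
Proof. by []. Qed.

Lemma windows_cat_ge (P : pred sym) (m : nat) (u v : seq sym) :
  windows P m u + windows P m v <= windows P m (u ++ v).
Proof.
elim: u => [//|x u IH]; rewrite cat_cons !windows_cons -addnA leq_add //.
case: (leqP m (size (x :: u))) => // mu; rewrite -cat_cons takel_cat // size_cat.
by rewrite (leq_trans mu (leq_addr _ _)).
Qed.

(** Only windows that start among the last [m.-1] letters of [u] can reach into [v]. *)
Lemma windows_cat_le (P : pred sym) (m : nat) (u v : seq sym) :
  windows P m (u ++ v) <= windows P m u + windows P m v + m.-1.
Proof.
elim: u => [|x u IH]; first by rewrite leq_addr.
have [mu|mu] := leqP m (size (x :: u)).
  rewrite cat_cons !windows_cons -!addnA leq_add // ?addnA //.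
  by rewrite -cat_cons takel_cat // mu; case: (m <= _).
rewrite [windows P m (x :: u)]windows_cons [m <= _]leqNgt mu /=.
have H w : size w <= m.-1 -> windows P m (w ++ v) <= size w + windows P m v.
  elim: w => // y w IHw hw; rewrite cat_cons windows_cons.
  by have := IHw (ltnW hw); case: (_ && _) => /=; lia.
have := H (x :: u); move: mu => /=; lia.
Qed.

Lemma windows_all (P : pred sym) (m : nat) (u : seq sym) :
  all P u -> size u <= windows P m u + m.-1.
Proof.
elim: u => // x u IH; rewrite windows_cons => /andP[Px Pu]; have := IH Pu.
case: (leqP m (size (x :: u))) => hm; last by move: hm => /=; lia.
have -> : all P (take m (x :: u)).
  by apply/allP => y /mem_take; apply/allP; rewrite /= Px.
rewrite /=; lia.
Qed.

Lemma windows_gt0 (P : pred sym) (m : nat) (u : seq sym) : 0 < windows P m u ->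
  exists v, [/\ infix v u, size v = m & all P v].
Proof.
elim: u => // x u IH; rewrite windows_cons; case: (boolP (_ && _)) => [/andP[h1 h2] _|_].
  exists (take m (x :: u)); split=> //; last by rewrite size_takel.
  exact/prefixW/prefix_take.
rewrite add0n => /IH[v [h1 h2 h3]]; exists v; split=> //.
by rewrite infix_consl h1 orbT.
Qed.

Lemma windows_infix (P : pred sym) (m : nat) (u v : seq sym) :
  infix v u -> windows P m v <= windows P m u.
Proof.
case/infixP => p [q ->]; apply: leq_trans (windows_cat_ge _ _ _ _).
by apply: leq_trans (leq_addl _ _); apply: leq_trans (windows_cat_ge _ _ _ _); rewrite leq_addr.
Qed.

(** No window fits inside a single expansion, so each one crosses a boundary, and at most [m.-1]
    cross a given boundary. Many windows therefore force a long [s]. *)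
Lemma windows_flatten (P : pred sym) (m : nat) (E : sym -> seq sym) (s : seq sym) :
  (forall x, windows P m (E x) = 0) ->
  windows P m (flatten (map E s)) <= m.-1 * size s.
Proof.
move=> HE; elim: s => //= x s IH; apply: leq_trans (windows_cat_le _ _ _ _) _.
rewrite HE mulnS; lia.
Qed.

(** Unlike [occ_seq], this counts overlapping occurrences too. *)
Fixpoint positions (v s : seq sym) : nat :=
  prefix v s + (if s is _ :: s' then positions v s' else 0).

Lemma positions_cat_ge (v p s : seq sym) : positions v s <= positions v (p ++ s).
Proof. by elim: p => //= x p IH; apply: leq_trans IH (leq_addl _ _). Qed.

Lemma positions_gt1 (v p q r : seq sym) : 0 < size v ->
  1 < positions v (p ++ v ++ q ++ v ++ r).
Proof.
case: v => // x v _; apply: leq_trans (positions_cat_ge _ _ _).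
have pre s : prefix (x :: v) (x :: v ++ s) by rewrite -cat_cons prefix_prefix.
rewrite /= -/(prefix (x :: v) (x :: _)) pre add1n ltnS; apply: leq_trans (positions_cat_ge _ _ _).
by apply: leq_trans (positions_cat_ge _ _ _); rewrite /= -/(prefix (x :: v) (x :: _)) pre.
Qed.

Lemma fresh_gt (A : slp) (X : nat) : X \in nonterms A -> X < fresh A.
Proof.
rewrite /fresh ltnS; elim: (nonterms A) => //= Y l IH.
by rewrite inE leq_max => /orP[/eqP->|/IH->]; rewrite ?leqnn ?orbT.
Qed.

(** * Rounds after the first ones *)

(* [E x] is the word over the symbols of [T] that [x] stands for; the nonterminals
   occurring in [T] itself are treated as letters. *)
Definition windowless (P : pred sym) (m : nat) (T : seq sym) (A : slp) : Prop :=
  exists s l E,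
  [/\ rules A = (0, s) :: l,
      flatten (map E s) = T,
      forall x, windows P m (E x) = 0,
      forall r, r \in l -> windows P m (flatten (map E r.2)) = 0
    & forall r X, r \in rules A -> inr X \in r.2 -> X < fresh A].

(** If [g] occurs in an auxiliary rule, its expansion inherits the absence of windows from there.
    Otherwise [g] occurs twice in the start rule, and a window in its expansion would occur twice in
    [T]. *)
Lemma windowless_maximal (P : pred sym) (m : nat) (T : seq sym)
    (E : sym -> seq sym) (s g : seq sym) (l : seq (nat * seq sym)) (a b : nat) :
  0 < m ->
  (forall v, size v = m -> all P v -> positions v T <= 1) ->
  flatten (map E s) = T ->
  (forall r, r \in l -> windows P m (flatten (map E r.2)) = 0) ->
  1 < occ (SLP ((a, s) :: l) b) g -> windows P m (flatten (map E g)) = 0.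
Proof.
move=> m0 U ET El o2; apply/eqP; rewrite -leqn0 leqNgt; apply/negP => w0.
case: (posnP (occ (SLP l b) g)) => [ol|/occ_gt0[r rl /infixP[p [q E1]]]].
  have /occ_seq_gt1[p [q [r Es]]] : 1 < occ_seq g s.
    by move: o2 ol; rewrite /occ /=; lia.
  have [v [/infixP[x [y Ev]] vm Pv]] := windows_gt0 w0.
  suff : 1 < positions v T by rewrite ltnNge U.
  rewrite -ET Es !map_cat !flatten_cat Ev.
  move: (flatten (map E p)) (flatten (map E q)) (flatten (map E r)) => p' q' r'.
  have -> : p' ++ (x ++ v ++ y) ++ q' ++ (x ++ v ++ y) ++ r' =
            (p' ++ x) ++ v ++ (y ++ q' ++ x) ++ v ++ (y ++ r') by rewrite -!catA.
  by apply: positions_gt1; rewrite vm.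
suff : windows P m (flatten (map E g)) <= 0 by lia.
rewrite -(El r rl) E1; apply: windows_infix.
by rewrite !map_cat !flatten_cat infix_infix.
Qed.

Lemma windowless_step (P : pred sym) (m : nat) (T : seq sym) (A B : slp) :
  0 < m ->
  (forall v, size v = m -> all P v -> positions v T <= 1) ->
  windowless P m T A -> repair_step A B -> windowless P m T B.
Proof.
move=> m0 U [s [l [E [rA ET E0 El fr]]]] [g [[g2 o2 _] _ ->]].
have g0 : 0 < size g by lia.
have Wg : windows P m (flatten (map E g)) = 0.
  by apply: (windowless_maximal (a := 0) (b := start A) m0 U ET El); move: o2; rewrite /occ rA.
have frg X : inr X \in g -> X < fresh A.
  have [|r rA' /infixP[p [q E1]]] := @occ_gt0 A g; first by lia.
  by move=> h; apply: (fr r) => //; rewrite E1 !mem_cat h orbT.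
(* The new nonterminal receives the expansion of [g]; freshness keeps [E] unchanged on all existing
   rules. *)
pose E' x := if x == inr (fresh A) then flatten (map E g) else E x.
have EE' t : (forall X, inr X \in t -> X < fresh A) -> map E' t = map E t.
  move=> ht; apply/eq_in_map => x xt; rewrite /E'; case: eqP => // xX.
  by have := ht (fresh A); rewrite -xX ltnn => /(_ xt).
have E'X : E' (inr (fresh A)) = flatten (map E' g) by rewrite EE' // /E' eqxx.
have frl r : r \in l -> forall X, inr X \in r.2 -> X < fresh A.
  by move=> rl X; apply: fr; rewrite rA inE rl orbT.
exists (repl_seq g (fresh A) s),
  (rcons [seq (r.1, repl_seq g (fresh A) r.2) | r <- l] (fresh A, g)), E'; split.
- by rewrite /replace_round /= rA.
- rewrite repl_seq_expand // EE' // => X; apply: (fr (0, s)).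
  by rewrite rA mem_head.
- by move=> x; rewrite /E'; case: ifP.
- move=> r; rewrite mem_rcons inE => /orP[/eqP->|/mapP[r' rl ->]] /=.
    by rewrite EE'.
  by rewrite repl_seq_expand // EE' ?El //; apply: frl.
have lt : fresh A < fresh (replace_round A g).
  by apply: fresh_gt; rewrite /nonterms /= map_rcons mem_rcons mem_head.
move=> r X; rewrite /= mem_rcons inE => /orP[/eqP->|/mapP[r' rA' ->]] /=.
  by move=> /frg; lia.
by move=> /repl_seq_mem[//|[->]|/(fr _ _ rA')]; lia.
Qed.

Lemma windowless_run (P : pred sym) (m : nat) (T : seq sym) (A B : slp) :
  0 < m ->
  (forall v, size v = m -> all P v -> positions v T <= 1) ->
  windowless P m T A -> repair_run A B ->
  windows P m T <= m.-1 * slp_size B.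
Proof.
move=> m0 U IA run; have : windowless P m T B.
  elim: run IA => // A1 B1 C1 st _ IH IA; apply: IH; exact: windowless_step st.
case=> s [l [E [rB <- E0 _ _]]]; apply: leq_trans (windows_flatten _ E0) _.
by rewrite leq_mul2l /slp_size rB /= leq_addr orbT.
Qed.

(** * The first rounds on a sequence of unary blocks *)

(** The symbol X_j, with X_0 the letter a encoded as 1. Nonterminal 0 is the start symbol, so X_j
    can carry the number j for positive j. *)
Definition sy (j : nat) : sym := if j is 0 then inl 1 else inr j.

(** The [j] lowest binary digits of [x], most significant first: a digit one of weight [2 ^ i] is
    written [sy i], and zeros are omitted. *)
Fixpoint low (j x : nat) : seq sym :=
  if j is i.+1 then nseq (odd (x %/ 2 ^ i)) (sy i) ++ low i x else [::].

(* The word [a^x b] after the creation of [X_1, ..., X_j], where [X_(i+1) -> X_i X_i]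
   and [X_0 = a]. *)
Definition block (j x : nat) : seq sym :=
  nseq (x %/ 2 ^ j) (sy j) ++ low j x ++ [:: inl 2].

Definition blocks (j : nat) (xs : seq nat) : seq sym := flatten (map (block j) xs).

Definition doubling_slp (xs : seq nat) (j : nat) : slp :=
  SLP ((0, blocks j xs) :: [seq (i.+1, [:: sy i; sy i]) | i <- iota 0 j]) 0.

Lemma lowS (j x : nat) :
  low j.+1 x = nseq (odd (x %/ 2 ^ j)) (sy j) ++ low j x.
Proof. by []. Qed.

Lemma sy_inj : injective sy.
Proof. by move=> [|i] [|j] //= [->]. Qed.

Lemma sy_neq2 (j : nat) : sy j != inl 2.
Proof. by case: j. Qed.

Lemma low_sub (j x : nat) (y : sym) : y \in low j x -> exists2 i, i < j & y = sy i.
Proof.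
elim: j => //= j IH; rewrite mem_cat => /orP[|/IH[i ij ->]]; last by exists i => //; apply: ltnW.
by rewrite mem_nseq => /andP[_ /eqP->]; exists j.
Qed.

Lemma sy_notin_low (i j x : nat) : j <= i -> sy i \notin low j x.
Proof. by move=> ji; apply/negP => /low_sub[k kj /sy_inj]; lia. Qed.

Lemma size_low (j x : nat) : size (low j x) <= j.
Proof. by elim: j => //= j IH; rewrite size_cat size_nseq; case: odd => /=; lia. Qed.

Lemma fresh_doubling (xs : seq nat) (j : nat) : fresh (doubling_slp xs j) = j.+1.
Proof.
congr S; rewrite /doubling_slp /nonterms /= -map_comp max0n.
have H n m : foldr maxn 0 (map S (iota m n)) = if n is 0 then 0 else m + n.
  elim: n m => //= n IH m; rewrite IH; case: n {IH} => [|n]; lia.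
by rewrite (eq_map (g := S)) // H; case: j.
Qed.

Lemma repl_block (j x : nat) (s : seq sym) :
  repl_seq [:: sy j; sy j] j.+1 (block j x ++ s) =
  block j.+1 x ++ repl_seq [:: sy j; sy j] j.+1 s.
Proof.
rewrite /block lowS -!catA [in low j x ++ _]catA repl_seq_run.
- by rewrite expnSr divnMA divn2 /= -!catA.
- by rewrite mem_cat inE (negbTE (sy_neq2 j)) orbF sy_notin_low.
- by rewrite size_cat addn1.
Qed.

Lemma repl_doubling (xs : seq nat) (j : nat) :
  replace_round (doubling_slp xs j) [:: sy j; sy j] = doubling_slp xs j.+1.
Proof.
have iotaS : iota 0 j.+1 = rcons (iota 0 j) j by rewrite -addn1 iotaD cats1.
rewrite /replace_round fresh_doubling /doubling_slp iotaS map_rcons /=.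
congr SLP; congr cons; last congr rcons.
- congr pair; rewrite /blocks; elim: xs => //= x xs IH.
  by rewrite repl_block IH.
- rewrite -map_comp; apply/eq_in_map => i; rewrite mem_iota add0n /= => ij.
  congr pair; apply: (@repl_seq_notin _ _ _ (sy j)); first by rewrite mem_head.
  by rewrite !inE orbb; apply/eqP => /sy_inj; lia.
Qed.

Lemma count_sy_blocks (xs : seq nat) (j : nat) :
  count (pred1 (sy j)) (blocks j xs) = sumn [seq x %/ 2 ^ j | x <- xs].
Proof.
rewrite /blocks; elim: xs => //= x xs IH; rewrite count_cat IH; congr addn.
rewrite /block !count_cat count_nseq /= eqxx mul1n eq_sym (negbTE (sy_neq2 j)) !addn0.
by rewrite (count_memPn _) ?addn0 // sy_notin_low.
Qed.

Lemma count_other_blocks (xs : seq nat) (j : nat) :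
  count (predC (pred1 (sy j))) (blocks j xs) <= size xs * j.+1.
Proof.
rewrite /blocks; elim: xs => //= x xs IH; rewrite count_cat mulSn leq_add //.
rewrite /block !count_cat count_nseq /= eqxx mul0n add0n addn0.
have := count_size (predC (pred1 (sy j))) (low j x); have := size_low j x.
by move=> h1 h2; rewrite -[j.+1]addn1 leq_add ?leq_b1 ?(leq_trans h2).
Qed.

Section Rounds.

Variables (xs : seq nat) (j : nat).
(** At most [size xs * j.+1 + 2 * j] letters of the program differ from [sy j]. If that bound is M
    and c counts the copies of [sy j], then c > 3M + 3 makes (c - M - 1) / 2 exceed both c / 3 and
    M. *)
Hypothesis large : 3 * (size xs * j.+1 + 2 * j) + 3 < sumn [seq x %/ 2 ^ j | x <- xs].

Let A := doubling_slp xs j.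
Let g2 := [:: sy j; sy j].

(** A competitor is either a power of [sy j] of length at least three, hence occurs at most c / 3
    times, or it contains one of the at most M other letters. *)
Lemma occ_other (g : seq sym) : 2 <= size g -> g != g2 -> occ A g < occ A g2.
Proof.
move=> gs ng.
have low2 : count (pred1 (sy j)) (blocks j xs) <=
    2 * occ A g2 + count (predC (pred1 (sy j))) (blocks j xs) + 1.
  apply: leq_trans (occ_seq_pair _ _) _.
  by rewrite !leq_add2r leq_mul2l /occ /= leq_addr.
have c0 : sumn [seq count (pred1 (sy j)) r.2 | r <-
    [seq (i.+1, [:: sy i; sy i]) | i <- iota 0 j]] = 0.
  have : all (gtn j) (iota 0 j) by apply/allP => i; rewrite mem_iota.
  elim: (iota 0 j) => //= i l IH /andP[ij /IH ->].
  by have -> : sy i == sy j = false by apply/eqP => /sy_inj; lia.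
have cn P : sumn [seq count P r.2 | r <-
    [seq (i.+1, [:: sy i; sy i]) | i <- iota 0 j]] <= 2 * j.
  rewrite -[j in _ * j](size_iota 0).
  by elim: (iota 0 j) => //= i l IH; case: (P _) => /=; lia.
have := occ_count (pred1 (sy j)) A g; have := occ_count (predC (pred1 (sy j))) A g.
rewrite /= c0 addn0; have := cn (predC (pred1 (sy j))).
have := count_other_blocks xs j; move: low2 large; rewrite count_sy_blocks.
move: (sumn _) (sumn _) (count _ (blocks _ _)) => a b c.
have [/eqP ga|] := eqVneq (count (pred1 (sy j)) g) (size g).
  have g3 : 3 <= size g.
    move: ng gs ga; rewrite -all_count; case: g => [|u [|v [|w g]]] //=.
    by rewrite andbT => /eqP ng _ /andP[/eqP u1 /eqP v1]; case: ng; rewrite u1 v1.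
  rewrite (eqP ga) => h1 h2 h3 h4 _ h5.
  have : occ A g * 3 <= occ A g * size g by rewrite leq_mul2l g3 orbT.
  lia.
rewrite -(count_predC (pred1 (sy j)) g) => ne h1 h2 h3 h4 h5 _.
have : occ A g * 1 <= occ A g * count (predC (pred1 (sy j))) g.
  by rewrite leq_mul2l; apply/orP; right; lia.
move: h2 h3 h5; rewrite muln1.
move: (occ A g) (occ A g2) (occ A g * _) (size xs * _) h1 h4 => o o2 u v h1 h4 h2 h3 h5 h6; lia.
Qed.

Lemma maximal_pair : maximal_string A g2.
Proof.
split=> //; last by move=> g sg; apply: occ_other; [apply: ltnW|apply/eqP => eg; rewrite eg in sg].
have := occ_seq_pair (sy j) (blocks j xs); have := count_other_blocks xs j.
have : occ_seq [:: sy j; sy j] (blocks j xs) <= occ A g2 by rewrite /occ /= leq_addr.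
rewrite count_sy_blocks; move: large; lia.
Qed.

(** The strict inequality of [occ_other] rules out ties, so the round is forced. *)
Lemma doubling_step (B : slp) : repair_step A B -> B = doubling_slp xs j.+1.
Proof.
case=> g [[gs _ _] /(_ _ maximal_pair) og ->].
have [->|/(occ_other gs)] := eqVneq g g2; first exact: repl_doubling.
by rewrite ltnNge og.
Qed.

End Rounds.

Lemma doubling_run (xs : seq nat) (k : nat) (B : slp) :
  (forall j, j < k ->
    3 * (size xs * j.+1 + 2 * j) + 3 < sumn [seq x %/ 2 ^ j | x <- xs]) ->
  repair_run (doubling_slp xs 0) B -> repair_run (doubling_slp xs k) B.
Proof.
elim: k => // k IH large /(IH (fun j jk => large j (ltnW jk))) run.
have lk := large k (leqnn _).
inversion run as [A1 stop E1 E2|A1 B1 C1 st run1 E1 E2].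
  by case: (stop _ (maximal_pair lk)).
by rewrite -(doubling_step lk st).
Qed.

Lemma doubling_init (xs : seq nat) :
  repair_init (flatten [seq nseq x 1 ++ [:: 2] | x <- xs]) = doubling_slp xs 0.
Proof.
rewrite /repair_init /doubling_slp /=; congr SLP; congr cons; congr pair.
rewrite /blocks; elim: xs => //= x xs IH; rewrite map_cat IH /block expn0 divn1 /=.
by rewrite map_cat map_nseq.
Qed.

(** * A bit sequence without repeated windows *)

(* Blocks [0 0 1 c_1 1 c_2 ... 1 c_p 1] of length [2p+3], block [q] carrying the [p]
   lowest binary digits of [q]; two consecutive zeros occur only at the beginning of
   a block, so a window of two block lengths reveals its position. *)
Definition marked (p t : nat) : bool :=
  let r := t %% (2 * p + 3) in
  if r < 2 then false
  else ~~ odd r || odd (t %/ (2 * p + 3) %/ 2 ^ (r./2).-1).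

Lemma marked_block (p q r : nat) : r < 2 * p + 3 ->
  marked p (q * (2 * p + 3) + r) =
  if r < 2 then false else ~~ odd r || odd (q %/ 2 ^ (r./2).-1).
Proof.
move=> hr; rewrite /marked modnMDl modn_small // divnMDl; last by rewrite addn3.
by rewrite (divn_small hr) addn0.
Qed.

(** Even offsets from 2 on are always marked, including the last offset [2 * p + 2], so no other
    pair of zeros arises inside a block or across its end. *)
Lemma marked_00 (p t : nat) : ~~ marked p t -> ~~ marked p t.+1 ->
  t %% (2 * p + 3) = 0.
Proof.
have l0 : 0 < 2 * p + 3 by lia.
rewrite [t](divn_eq t (2 * p + 3)); move: (t %/ _) (t %% _) (ltn_pmod t l0) => q r hr.
rewrite modnMDl modn_small // marked_block // -addnS.
case: (ltnP r.+1 (2 * p + 3)) => hr'; last first.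
  have -> : r = 2 * p.+1 by lia.
  by rewrite oddM; case: ltnP => //; lia.
rewrite marked_block //=; case: r hr hr' => [|[|r]] //=; case: (odd r) => //=.
Qed.

(** Three zeros in a row would make two adjacent positions both block starts. *)
Lemma marked_dense (p t : nat) :
  0 < marked p t + marked p t.+1 + marked p t.+2.
Proof.
case E0 : (marked p t) => //; case E1 : (marked p t.+1) => //.
case E2 : (marked p t.+2) => //.
have := marked_00 (negbT E0) (negbT E1); have := marked_00 (negbT E1) (negbT E2).
rewrite -addn1 -modnDml => h1 h2; move: h1; rewrite h2 modn_small //; lia.
Qed.

(** A block starts among the first [2 * p + 3] positions of the window and is recognised by its two
    zeros, at the same offset for [t']. The digits after it spell the block number, which the bounds
    keep below [2 ^ p]. *)
Lemma marked_window (p t t' : nat) :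
  t + 2 * p + 3 <= 2 ^ p * (2 * p + 3) -> t' + 2 * p + 3 <= 2 ^ p * (2 * p + 3) ->
  (forall x, x < 2 * (2 * p + 3) -> marked p (t + x) = marked p (t' + x)) ->
  t = t'.
Proof.
set l := 2 * p + 3 => ht ht' H; have l0 : 0 < l by rewrite /l; lia.
have [x xl [q Eq]] : exists2 x, x < l & exists q, t + x = q * l.
  have h := ltn_pmod t l0; case: (posnP (t %% l)) => r0.
    by exists 0 => //; exists (t %/ l); rewrite addn0 {1}(divn_eq t l) r0 addn0.
  exists (l - t %% l); first by lia.
  by exists (t %/ l).+1; rewrite {1}(divn_eq t l) mulSn; lia.
have [q' Eq'] : exists q', t' + x = q' * l.
  exists ((t' + x) %/ l); rewrite {1}(divn_eq (t' + x) l) marked_00 ?addn0 //.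
    rewrite -H ?Eq; last by lia.
    by rewrite -[q * l]addn0 marked_block.
  rewrite -addnS -H ?addnS ?Eq; last by rewrite /l in xl *; lia.
  by rewrite -[(q * l).+1]addn1 marked_block //; lia.
suff qq : q = q' by apply/eqP; rewrite -(eqn_add2r x) Eq Eq' qq.
have {ht} hq : q < 2 ^ p by rewrite -(ltn_pmul2r l0) -Eq; rewrite /l in xl *; lia.
have {ht'} hq' : q' < 2 ^ p by rewrite -(ltn_pmul2r l0) -Eq'; rewrite /l in xl *; lia.
have bits i : i < p -> odd (q %/ 2 ^ i) = odd (q' %/ 2 ^ i).
  (* The digit of weight [2 ^ i] sits at the odd offset [2 * i + 3] of its block. *)
  move=> ip; have [r [rl ro r2 ri]] : exists r, [/\ r < l, odd r, 2 <= r & (r./2).-1 = i].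
    by exists (2 * i + 3); rewrite oddD mul2n odd_double /l; split=> //; lia.
  have := H (x + r); rewrite !addnA Eq Eq' !marked_block // (ltnNge r) r2 ro ri /=.
  by apply; lia.
clear -hq hq' bits; elim: p q q' hq hq' bits => [|p IH] q q' hq hq' bits.
  by move: hq hq'; rewrite expn0; lia.
have := bits 0 isT; rewrite expn0 !divn1 => o.
rewrite -(odd_double_half q) -(odd_double_half q') o; congr (_ + _.*2).
apply: IH; try by move: hq hq'; rewrite expnS; lia.
by move=> i ip; have := bits i.+1 ip; rewrite expnS !divnMA !divn2.
Qed.

(** * The exponents *)

(** The shift by two skips the initial zeros of the bit sequence; the leading digit of every
    exponent is then [marked p 2], which is one. *)
Fixpoint expo (p i : nat) : nat :=
  if i is i'.+1 then 2 * expo p i' + marked p i.+2 else 1.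

Lemma expo_ge (p i : nat) : 2 ^ i <= expo p i.
Proof. by elim: i => //= i IH; rewrite expnS; lia. Qed.

Lemma expo_lt (p i : nat) : expo p i < 2 ^ i.+1.
Proof. by elim: i => //= i IH; rewrite expnS; case: marked => /=; lia. Qed.

Lemma expo_bit (p i j : nat) : j <= i ->
  odd (expo p i %/ 2 ^ j) = marked p (i - j).+2.
Proof.
elim: i j => [|i IH] [|j] // ji.
- by rewrite expn0 divn1 /marked modn_small // addn3.
- by rewrite expn0 divn1 oddD oddM subn0; case: (marked p i.+3).
- rewrite subSS -IH // [expo p i.+1]/= mulnC.
  by rewrite expnS divnMA divnMDl //; case: (marked p i.+3); rewrite addn0.
Qed.

Lemma expo_bit_large (p i j : nat) : i < j -> odd (expo p i %/ 2 ^ j) = false.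
Proof.
by move=> ij; rewrite divn_small // (leq_trans (expo_lt p i)) // leq_exp2l.
Qed.

(** By [marked_dense], each group of three consecutive digits contributes at least one symbol. *)
Lemma size_low_expo (p i q : nat) : 3 * q <= i.+1 -> q <= size (low (3 * q) (expo p i)).
Proof.
elim: q => // q IH qi; rewrite [3 * q.+1]mulnS addnC !addnS addn0.
rewrite !lowS !size_cat !size_nseq !expo_bit; try lia.
have := marked_dense p (i - (3 * q).+2).+2; have := IH;
have -> : (i - (3 * q).+1) = (i - (3 * q).+2).+1 by lia.
have -> : (i - (3 * q)) = (i - (3 * q).+2).+2 by lia.
by lia.
Qed.

(** * Long windows occur only once *)

Lemma prefix_sep (v u w : seq sym) (b : sym) : b \notin v ->
  prefix v (u ++ b :: w) = prefix v u.
Proof.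
elim: v u => [|x v IH] [|y u] //=; rewrite inE negb_or => /andP[nb bv].
  by rewrite eq_sym (negbTE nb).
by rewrite IH.
Qed.

Lemma positions_cons (v s : seq sym) (b : sym) : 0 < size v -> b \notin v ->
  positions v (b :: s) = positions v s.
Proof. by move=> v0 /(prefix_sep [::] s) /= ->; case: v v0. Qed.

Lemma positions_sep (v u w : seq sym) (b : sym) : 0 < size v -> b \notin v ->
  positions v (u ++ b :: w) = positions v u + positions v w.
Proof.
move=> v0 bv; elim: u => [|x u IH].
  by rewrite positions_cons //; case: v v0 {bv}.
have E : prefix v (x :: u ++ b :: w) = prefix v (x :: u) by exact: (prefix_sep (x :: u) w bv).
by rewrite [LHS]/= -/(prefix v (x :: _)) E IH addnA.
Qed.

Lemma positions_count (v s : seq sym) (y : sym) :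
  positions (y :: v) s <= count_mem y s.
Proof.
elim: s => // x s IH /=; rewrite leq_add //.
by rewrite eq_sym; case: eqP => //=; case: prefix.
Qed.

Lemma positions_gt0 (v s : seq sym) : 0 < positions v s -> infix v s.
Proof.
elim: s => [|x s IH]; first by case: v.
rewrite infix_consl [positions _ _]/= -/(prefix v (x :: s)).
by case: (prefix v (x :: s)) => //=.
Qed.

Lemma sumn_le1 (f : nat -> nat) (l : seq nat) : uniq l ->
  (forall i, f i <= 1) ->
  (forall i i', i \in l -> i' \in l -> 0 < f i -> 0 < f i' -> i = i') ->
  sumn (map f l) <= 1.
Proof.
move=> + f1; elim: l => //= i l IH /andP[il ul] H.
case: (posnP (f i)) => [->|fi].
  by apply: IH => // j j' jl jl'; apply: H; rewrite inE ?jl ?jl' orbT.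
suff -> : sumn (map f l) = 0 by rewrite addn0.
have : {in l, forall j, f j = 0}.
  move=> j jl; case: (posnP (f j)) => // fj.
  by move: il; rewrite (H i j) ?jl // inE ?eqxx ?jl ?orbT.
elim: l {IH il ul H} => //= j l IH Hl; rewrite Hl ?mem_head // IH // => j' jl.
by apply: Hl; rewrite inE jl orbT.
Qed.

Lemma count_low (j x : nat) (y : sym) : count_mem y (low j x) <= 1.
Proof.
elim: j => // j IH; rewrite lowS count_cat count_nseq /=.
case: eqP => [<-|_]; last by rewrite mul0n.
by rewrite (count_memPn (sy_notin_low _ _)) // addn0 mul1n leq_b1.
Qed.

Lemma low_suffix (k j x : nat) (p r : seq sym) :
  low k x = p ++ sy j :: r -> odd (x %/ 2 ^ j) /\ r = low j x.
Proof.
elim: k p => [|k IH] [|y p] //; rewrite lowS; case o : (odd _); try exact: IH.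
  by move=> [/sy_inj <- <-].
by move=> [_ /IH].
Qed.

(** Symbols carry their index, so the omitted zeros are visible as gaps. Indices strictly decrease,
    hence the symbols of [v] fix at least [size v] consecutive digits below [j]. *)
Lemma low_prefix (v : seq sym) (j x x' : nat) :
  prefix v (low j x) -> prefix v (low j x') ->
  size v <= j /\
  forall y, y < size v -> odd (x %/ 2 ^ (j - y.+1)) = odd (x' %/ 2 ^ (j - y.+1)).
Proof.
elim: j v => [|j IH] [|u v]; rewrite ?lowS //.
have N z w : prefix (sy j :: w) (low j z) = false.
  apply/negP => /prefixP[r E]; have := @sy_notin_low j j z (leqnn _).
  by rewrite E mem_head.
case o : (odd (x %/ 2 ^ j)); case o' : (odd (x' %/ 2 ^ j)).
- move=> /andP[_ h] /andP[_ h']; have [h1 h2] := IH v h h'; split=> //.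
  by case=> [|y] hy; rewrite ?subn1 ?o ?o' // subSS h2.
- by move=> /andP[/eqP -> _] h; have := N x' v; rewrite (h : prefix _ (low j x') = true).
- move=> h /andP[/eqP E _]; rewrite E in h; have := N x v.
  by rewrite (h : prefix _ (low j x) = true).
- move=> h h'; have [h1 h2] := IH _ h h'; split; first exact: ltnW.
  by case=> [|y] hy; rewrite ?subn1 ?o ?o' // subSS h2 // ltnW.
Qed.

Lemma low_expo_window (p k i i' : nat) (v : seq sym) :
  i + 2 * p + 5 <= 2 ^ p * (2 * p + 3) -> i' + 2 * p + 5 <= 2 ^ p * (2 * p + 3) ->
  size v = 2 * (2 * p + 3) ->
  infix v (low k (expo p i)) -> infix v (low k (expo p i')) -> i = i'.
Proof.
move=> hi hi' sv; case: v sv => [|u v] sv; first by move: sv => /=; lia.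
case/infixP => [a [b E]] /infixP[a' [b' E']].
have [j _ uj] : exists2 j, j < k & u = sy j.
  by apply: (@low_sub _ (expo p i)); rewrite E mem_cat mem_head orbT.
move: E E'; rewrite uj => /low_suffix[o Ev] /low_suffix[o' Ev'].
have ji : j <= i by rewrite leqNgt; apply: contraL o => /expo_bit_large ->.
have ji' : j <= i' by rewrite leqNgt; apply: contraL o' => /expo_bit_large ->.
have [||vj H] := @low_prefix v j (expo p i) (expo p i').
- by rewrite -Ev prefix_prefix.
- by rewrite -Ev' prefix_prefix.
(* Digit [j] of [expo p i] is the bit at [(i - j).+2]; the digits from there downwards form a window
   of the bit sequence. *)
suff : (i - j).+2 = (i' - j).+2 by lia.
apply: (@marked_window p); try lia.
move: sv => /= sv; case=> [|y] hy; first by rewrite !addn0 -!expo_bit // o o'.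
have yv : y < size v by lia.
have -> : (i - j).+2 + y.+1 = (i - (j - y.+1)).+2 by lia.
have -> : (i' - j).+2 + y.+1 = (i' - (j - y.+1)).+2 by lia.
by rewrite -!expo_bit ?H //; lia.
Qed.

(** Excludes [sy k] and the letter b, which thus act as separators: a string of digits lies within
    one [low k x]. *)
Definition is_digit (k : nat) : pred sym := fun y => y \in map sy (iota 0 k).

Lemma is_digit_low (k x : nat) : all (is_digit k) (low k x).
Proof.
apply/allP => y /low_sub[j jk ->]; apply: map_f; by rewrite mem_iota.
Qed.

Lemma positions_blocks (k : nat) (xs : seq nat) (v : seq sym) :
  0 < size v -> all (is_digit k) v ->
  positions v (blocks k xs) = sumn [seq positions v (low k x) | x <- xs].
Proof.
move=> v0 /allP dv.
have sep : inl 2 \notin v.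
  apply/negP => /dv /mapP[j _ /eqP]; rewrite eq_sym; exact/negP/sy_neq2.
have top : sy k \notin v.
  by apply/negP => /dv /mapP[j]; rewrite mem_iota => jk /sy_inj; lia.
rewrite /blocks; elim: xs => [|x xs IH] /=; first by case: v v0 {dv sep top}.
rewrite -IH /block -!catA; elim: (x %/ _) => [|c IHc]; first by rewrite positions_sep.
by rewrite [nseq _ _]/= cat_cons positions_cons.
Qed.

(** Within one block [v] occurs at most once because its first symbol does; [low_expo_window]
    excludes two different blocks. *)
Lemma positions_expo (p k n : nat) (v : seq sym) :
  n + 2 * p + 4 <= 2 ^ p * (2 * p + 3) ->
  size v = 2 * (2 * p + 3) -> all (is_digit k) v ->
  positions v (blocks k [seq expo p i | i <- iota 0 n]) <= 1.
Proof.
move=> hn sv dv; rewrite positions_blocks //; last by rewrite sv; lia.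
rewrite -map_comp; apply: sumn_le1; first exact: iota_uniq.
  move=> i /=; case: v sv {dv} => [|y v] sv; first by move: sv => /=; lia.
  exact: leq_trans (positions_count _ _ _) (count_low _ _ _).
move=> i i'; rewrite !mem_iota /= => hi hi' /positions_gt0 h /positions_gt0 h'.
by apply: low_expo_window sv h h'; lia.
Qed.

Lemma windows_blocks (k m : nat) (xs : seq nat) :
  sumn [seq size (low k x) - m.-1 | x <- xs] <= windows (is_digit k) m (blocks k xs).
Proof.
rewrite /blocks; elim: xs => //= x xs IH.
apply: leq_trans (windows_cat_ge _ _ _ _); rewrite leq_add // leq_subLR addnC.
apply: leq_trans (windows_all m (is_digit_low k x)) _; rewrite leq_add2r.
by apply: windows_infix; apply: infix_infix.
Qed.

(** * A small program *)

Definition expo_word (p n : nat) : seq nat :=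
  flatten [seq nseq x 1 ++ [:: 2] | x <- [seq expo p i | i <- iota 0 n]].

Definition expo_rhs (p i : nat) : seq sym :=
  if i is j.+1 then [:: inr j; inr j] ++ nseq (marked p j.+3) (inl 1)
  else [:: inl 1].

Definition expo_slp (p n : nat) : slp :=
  SLP ((n, flatten [seq [:: inr i; inl 2] | i <- iota 0 n]) ::
       [seq (i, expo_rhs p i) | i <- iota 0 n]) n.

Lemma expo_slp_size (p n : nat) : slp_size (expo_slp p n) <= 5 * n.
Proof.
rewrite /slp_size /= -[X in _ <= 5 * X](size_iota 0).
elim: (iota 0 n) => //= i l IH.
have : size (expo_rhs p i) <= 3 by case: i => //= i; case: marked.
lia.
Qed.

Lemma expo_slp_nonterms (p n : nat) : nonterms (expo_slp p n) = n :: iota 0 n.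
Proof. by rewrite /nonterms /= -map_comp map_id. Qed.

(** Rules refer only to smaller nonterminals, which gives acyclicity. *)
Lemma expo_slp_rule (p n : nat) (r : nat * seq sym) (X : nat) :
  r \in rules (expo_slp p n) -> inr X \in r.2 -> X < r.1 <= n.
Proof.
rewrite inE => /orP[/eqP->|/mapP[i]] /=.
  by case/flatten_mapP => i; rewrite mem_iota !inE orbF => hi /eqP[->]; lia.
rewrite mem_iota => hi -> /=; case: i hi => [|i] hi; first by rewrite inE.
by rewrite !inE mem_nseq andbF orbF orbb => /eqP[->]; lia.
Qed.

Lemma expo_slp_wf (p n : nat) : 0 < n -> slp_wf (expo_slp p n).
Proof.
move=> n0; split.
- by rewrite expo_slp_nonterms /= mem_iota ltnn iota_uniq.
- by rewrite expo_slp_nonterms mem_head.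
- rewrite /= all_map; apply/andP; split; first by case: n n0.
  by apply/allP => -[|i].
- apply/allP => r hr; apply/allP => -[//|X] hX.
  by rewrite expo_slp_nonterms inE mem_iota; have := expo_slp_rule hr hX; lia.
- have lt C B : occurs_rel (expo_slp p n) C B -> B < C.
    by case/hasP => r hr /andP[/eqP <- hB]; case/andP: (expo_slp_rule hr hB).
  have H s C : path (occurs_rel (expo_slp p n)) C s -> last C s <= C.
    elim: s C => //= B s IH C /andP[/lt BC /IH]; lia.
  by move=> C [//|B s] /= /andP[/lt BC /H hs] E; lia.
Qed.

Lemma dseq_nseq (A : slp) (a k : nat) : dseq A (nseq k (inl a)) (nseq k a).
Proof.
elim: k => [|k IH]; first exact: dseq_nil.
exact: (@dseq_cons _ _ _ [:: a] _ (dsym_T _ _) IH).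
Qed.

Lemma dsym_expo (p n i : nat) : i < n ->
  dsym (expo_slp p n) (inr i) (nseq (expo p i) 1).
Proof.
have rul j : j < n -> (j, expo_rhs p j) \in rules (expo_slp p n).
  by move=> jn; rewrite inE (map_f (fun i => (i, expo_rhs p i))) ?orbT // mem_iota.
elim: i => [|i IH] hi; apply: (dsym_N (rul _ hi)).
  exact: (@dseq_nseq _ 1 1).
rewrite [expo p i.+1]/= mulSn mul1n -addnA !nseqD.
have h := IH (ltnW hi).
apply: dseq_cons => //; apply: dseq_cons => //; exact: dseq_nseq.
Qed.

Lemma expo_slp_for (p n : nat) : 0 < n -> slp_for (expo_slp p n) (expo_word p n).
Proof.
move=> n0; split; first exact: expo_slp_wf.
apply: dsym_N; first exact: mem_head.
rewrite /expo_word -map_comp.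
have : all (gtn n) (iota 0 n) by apply/allP => i; rewrite mem_iota.
elim: (iota 0 n) => [_|i l IH /= /andP[hi /IH hl]]; first exact: dseq_nil.
rewrite -catA; apply: dseq_cons; first exact: dsym_expo.
exact: (dseq_cons (dsym_T _ 2) hl).
Qed.

(** The last block alone gives the lower bound. Together the bounds make the logarithm of the length
    linear in the number of blocks. *)
Lemma expo_word_bounds (p n : nat) : 2 ^ n <= size (expo_word p n.+1) <= 4 ^ n.+1.
Proof.
have E m : expo_word p m.+1 = expo_word p m ++ nseq (expo p m) 1 ++ [:: 2].
  by rewrite /expo_word -{1}[m.+1]addn1 iotaD !map_cat flatten_cat /= cats0.
have S m : size (expo_word p m.+1) = size (expo_word p m) + (expo p m).+1.
  by rewrite E !size_cat size_nseq addn1.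
rewrite S; apply/andP; split; first by have := expo_ge p n; lia.
rewrite -S; elim: n.+1 => // m IH; rewrite S expnS.
have := expo_lt p m; have : 2 ^ m.+1 <= 2 * 4 ^ m.
  by rewrite expnS leq_mul2l (expnMn 2 2) leq_pmulr ?expn_gt0.
by have := expn_gt0 4 m; lia.
Qed.

Lemma expo_word_alphabet (p n : nat) :
  all (fun a => a \in [:: 1; 2]) (expo_word p n).
Proof.
apply/allP => a /flatten_mapP[x _]; rewrite mem_cat mem_nseq => /orP[/andP[_ /eqP->]|] //.
by rewrite !inE => ->; rewrite orbT.
Qed.

(** * The ratio *)

(** The initial expansion is the identity, and the auxiliary right-hand sides, of length two, are
    too short for a window. *)
Lemma windowless_doubling (m k : nat) (P : pred sym) (xs : seq nat) : 2 < m ->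
  windowless P m (blocks k xs) (doubling_slp xs k).
Proof.
move=> m2; have short s : size s <= 2 -> windows P m s = 0.
  elim: s => // x s IH hs; rewrite windows_cons IH; last exact: ltnW.
  by have -> : (m <= size (x :: s)) = false by lia.
have E1 s : flatten [seq [:: x] | x <- s] = s :> seq sym.
  by elim: s => //= x s ->.
exists (blocks k xs), [seq (i.+1, [:: sy i; sy i]) | i <- iota 0 k], (fun x => [:: x]).
split=> //.
- by move=> x; rewrite short.
- by move=> r /mapP[i _ ->]; rewrite E1 short.
have syX i X : inr X = sy i -> X = i by case: i => //= i [].
move=> r X; rewrite fresh_doubling inE => /orP[/eqP->|/mapP[i]] /=.
  case/flatten_mapP => x _; rewrite !mem_cat mem_nseq.
  move=> /or3P[/andP[_ /eqP/syX->]|/low_sub[i ik /syX->]|] //.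
  exact: leqW.
by rewrite mem_iota => /= ik ->; rewrite !inE orbb => /eqP/syX->; lia.
Qed.

(** With q = [2 ^ p], the last 6q of the 9q blocks each have at least q digits after 3q rounds,
    hence at least q - (4p + 5) windows of length 4p + 6. As q >= 8p + 10, this is at least q / 2
    per block and 3q^2 in total. *)
Lemma repair_lower (p : nat) (A : slp) : 7 <= p ->
  repair_result (expo_word p (9 * 2 ^ p)) A ->
  3 * 2 ^ p * 2 ^ p <= (4 * p + 5) * slp_size A.
Proof.
move=> p7; set q := 2 ^ p; set xs := [seq expo p i | i <- iota 0 (9 * q)].
have q8 : 8 * p + 10 <= q.
  rewrite /q -(subnKC p7); elim: (p - 7) => // k IH.
  by rewrite addnS expnS; move: (2 ^ _) IH => x IH; lia.
rewrite /repair_result doubling_init -/xs => run0.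
have {run0} run : repair_run (doubling_slp xs (3 * q)) A.
  apply: doubling_run run0 => j jk.
  (* The last exponent alone is at least [2 ^ (9 * q).-1], and [j] is below [3 * q]. *)
  have lo : 2 ^ (6 * q) <= sumn [seq x %/ 2 ^ j | x <- xs].
    rewrite /xs (_ : 9 * q = (9 * q).-1 + 1); last by lia.
    rewrite iotaD !map_cat sumn_cat /= addn0; apply: leq_trans (leq_addl _ _).
    rewrite leq_divRL ?expn_gt0 // -expnD; apply: leq_trans (expo_ge _ _).
    by rewrite leq_exp2l; lia.
  apply: leq_trans lo; rewrite /xs size_map size_iota.
  have qq := ltn_expl q (leqnn 2); have q10 : 2 ^ 10 <= 2 ^ (4 * q) by rewrite leq_exp2l; lia.
  (* The dominance condition asks for at most [81 * q * q + 18 * q + 3], which is below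
     [1024 * q * q]. *)
  have : q * q * 2 ^ 10 <= 2 ^ (6 * q).
    have -> : 6 * q = q + q + 4 * q by lia.
    rewrite (expnD 2 (q + q)) (expnD 2 q).
    by rewrite !leq_mul ?(ltnW qq).
  rewrite (_ : 2 ^ 10 = 1024) //; nia.
rewrite (_ : 4 * p + 5 = (2 * (2 * p + 3)).-1); last by lia.
have m2 : 2 < 2 * (2 * p + 3) by lia.
have unique v : size v = 2 * (2 * p + 3) -> all (is_digit (3 * q)) v ->
    positions v (blocks (3 * q) xs) <= 1.
  by move=> sv dv; apply: positions_expo => //; rewrite -/q; nia.
apply: leq_trans (windowless_run (ltnW (ltnW m2)) unique
  (windowless_doubling _ _ _ m2) run).
apply: leq_trans (windows_blocks _ _ _).
(* The first [3 * q] blocks are discarded: their exponents may have too few digits. *)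
have E : 9 * q = 3 * q + 6 * q by lia.
rewrite /xs E iotaD !map_cat sumn_cat; apply: leq_trans (leq_addl _ _).
rewrite add0n -map_comp.
have : all (leq (3 * q)) (iota (3 * q) (6 * q)) by apply/allP => i; rewrite mem_iota; lia.
move: (size_iota (3 * q) (6 * q)); move: (iota _ _) => l sl al.
suff : size l * (q - (4 * p + 5)) <=
    sumn [seq ((fun x => size (low (3 * q) x) - (2 * (2 * p + 3)).-1) \o expo p) i | i <- l].
  by apply: leq_trans; rewrite sl; nia.
elim: l al {sl} => //= i l IH /andP[hi /IH hl]; rewrite mulSn leq_add //.
have := @size_low_expo p i q; lia.
Qed.

Lemma INR_expn (a k : nat) : INR (a ^ k) = (INR a ^ k)%R.
Proof. by elim: k => //= k IH; rewrite expnS mult_INR IH. Qed.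

Lemma log2_le (x y : R) : (0 < x -> x <= y -> log2 x <= log2 y)%R.
Proof.
move=> x0 xy; apply: Rmult_le_compat_r.
  by apply/Rlt_le/Rinv_0_lt_compat; have := ln_lt_2; lra.
by case: xy => [xy|->]; [apply/Rlt_le/ln_increasing|apply: Rle_refl].
Qed.

Lemma log2_expn (k : nat) : log2 (INR (2 ^ k)) = INR k.
Proof.
have h := ln_lt_2; rewrite /log2 INR_expn ln_pow; last by rewrite /=; lra.
by rewrite (_ : INR 2 = 2%R) //; field; lra.
Qed.

Lemma le_INR_leq (m n : nat) : m <= n -> (INR m <= INR n)%R.
Proof. by move/leP; apply: le_INR. Qed.

Theorem theorem1 :
  exists c : R, (0 < c)%R /\
  forall N : nat, exists n : nat, (N <= n)%N /\
    exists w : seq nat,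
      [/\ size w = n, all (fun a => a \in [:: 1; 2]) w,
          exists A, repair_result w A &
          exists m, is_g w m /\
            forall A, repair_result w A ->
              (INR (slp_size A) / INR m >=
               c * log2 (INR n) / log2 (log2 (INR n)))%R].
Proof.
(* Here 1350 = 75 * 18. Since 4p + 5 <= 5p, the output has size at least 3q^2 / (5p), and g is at
   most 45q, so the ratio is at least q / (75p); moreover the logarithm of the length is at most 18q
   and its logarithm at least p. *)
exists (/ 1350)%R; split; first by lra.
move=> N; pose p := N + 7; pose q := 2 ^ p; pose w := expo_word p (9 * q).
have q0 : 0 < q by rewrite expn_gt0.
have /andP[n1 n2] : 2 ^ q <= size w <= 4 ^ (9 * q).
  have := expo_word_bounds p (9 * q).-1; rewrite prednK ?muln_gt0 // => /andP[h ->].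
  by rewrite andbT (leq_trans _ h) // leq_exp2l //; lia.
exists (size w); split.
  apply: leq_trans n1; apply: leq_trans (ltnW (ltn_expl q (leqnn 2))).
  apply: leq_trans (ltnW (ltn_expl p (leqnn 2))); exact: leq_addr.
exists w; split=> //; [exact: expo_word_alphabet|exact: repair_run_exists|].
have [|m [[G [GA Gm]] m45 mmin]] := @ex_minimum
  (fun s => exists A, slp_for A w /\ slp_size A = s) (slp_size (expo_slp p (9 * q))).
  by exists (expo_slp p (9 * q)); split=> //; apply: expo_slp_for; rewrite muln_gt0.
exists m; split.
  by split; [exists G|move=> A hA; apply: mmin; exists A].
move=> A /repair_lower -/(_ (leq_addl _ _)); rewrite -/q => lower.
have {}m45 : m <= 45 * q by apply: leq_trans m45 _; have := expo_slp_size p (9 * q); lia.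
have m0 : 0 < m.
  case: GA => -[_ st /allP pos _ _] _; rewrite -Gm /slp_size.
  case/mapP: st => r rG _; have := pos r rG.
  elim: (rules G) rG => //= r' l IH; rewrite inE => /orP[/eqP->|/IH h /h]; lia.
have lw1 : (INR q <= log2 (INR (size w)))%R.
  rewrite -(log2_expn q); apply: log2_le; last exact: le_INR_leq.
  by apply/lt_0_INR/ltP; rewrite expn_gt0.
have lw2 : (log2 (INR (size w)) <= 18 * INR q)%R.
  rewrite (_ : 18 * INR q = INR (18 * q))%R; last by rewrite mult_INR /=; ring.
  rewrite -(log2_expn (18 * q)); apply: log2_le.
    by apply/lt_0_INR/ltP; apply: leq_trans n1; rewrite expn_gt0.
  apply: le_INR_leq; have -> : 18 * q = 2 * (9 * q) by rewrite mulnA.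
  by rewrite (expnM 2 2).
have q0R : (0 < INR q)%R by apply/lt_0_INR/ltP.
have llw : (INR p <= log2 (log2 (INR (size w))))%R.
  by rewrite -(log2_expn p); apply: log2_le.
have m0R : (0 < INR m)%R by apply/lt_0_INR/ltP.
have p7 : (7 <= INR p)%R.
  by rewrite (_ : 7 = INR 7)%R; [apply: le_INR_leq; apply: leq_addl|rewrite /=; ring].
have mR : (INR m <= 45 * INR q)%R.
  rewrite (_ : 45 * INR q = INR (45 * q))%R; first exact: le_INR_leq.
  by rewrite mult_INR /=; ring.
have lowerR : (3 * INR q * INR q <= (4 * INR p + 5) * INR (slp_size A))%R.
  have := le_INR_leq lower; rewrite !mult_INR plus_INR mult_INR /=; lra.
move: lw1 lw2 llw m0R p7 mR lowerR q0R.
move: (log2 _) (log2 (log2 _)) (INR q) (INR p) (INR m) (INR (slp_size A)).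
move=> lg ll Q P M S lw1 lw2 llw m0R p7 mR lowerR q0R; apply: Rle_ge.
have P0 : (0 < P)%R by lra.
apply: (Rle_trans _ (Q / (75 * P))).
  apply: (Rle_trans _ (/ 1350 * (18 * Q) / P)); last by apply: Req_le; field; lra.
  apply: Rmult_le_compat; try lra.
    by apply/Rlt_le/Rinv_0_lt_compat; lra.
  exact: Rinv_le_contravar.
(* Clearing denominators leaves QM <= 75PS, which follows from QM <= 45Q^2 <= 15(4P + 5)S. *)
apply: (Rmult_le_reg_r (M * (75 * P))); first by nra.
rewrite (_ : Q / (75 * P) * (M * (75 * P)) = Q * M)%R; last by field; lra.
rewrite (_ : S / M * (M * (75 * P)) = 75 * P * S)%R; last by field; lra.
have S0 : (0 <= S)%R by nra.
nra.
Qed.
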